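(* Let $G$ be a finite non-cyclic nilpotent group. If $H$ is a group such that $|Cyc(G)|=|Cyc(H)|=1$ and $\Gamma_G\cong\Gamma_H$, then $H$ is a finite nilpotent group. Furthermore, for every prime number $p$ dividing $|G|$, if $P$ and $Q$ are Sylow $p$-subgroups of $G$ and $H$, respectively, then $\Gamma_P\cong\Gamma_Q$.
   Context: A group is locally cyclic if each of its finitely generated subgroups is cyclic. For a group $G$, $Cyc(G)=\{x\in G : \langle x,y\rangle \text{ is cyclic for all } y\in G\}$. For a non locally cyclic group $G$, the non-cyclic graph $\Gamma_G$ is the simple graph with vertex set $G\setminus Cyc(G)$ in which two distinct vertices $x,y$ are adjacent if and only if $\langle x,y\rangle$ is not cyclic. $\Gamma_G\cong\Gamma_H$ means that $G$ and $H$ are non locally cyclic groups and the two graphs are isomorphic. *)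

(* Defs.v *)
From mathcomp Require Import all_boot all_fingroup all_solvable.
From mathcomp Require Import boolp classical_sets functions cardinality.

Set Implicit Arguments.
Unset Strict Implicit.
Unset Printing Implicit Defensive.

Local Open Scope classical_set_scope.
Local Open Scope group_scope.

(* Subgroups of a possibly infinite group T are represented by classical sets
   A : set T; the notions below are meant to be applied to such an A. *)

Definition gen_subgroup (T : groupType) (S : set T) : set T :=
  smallest (fun A : set T => group_closed (mem A)) S.

Definition is_cyclic (T : groupType) (A : set T) : Prop :=
  exists z : T, A = gen_subgroup [set z].

Definition locally_cyclic (T : groupType) (A : set T) : Prop :=
  forall S : set T, finite_set S -> S `<=` A -> is_cyclic (gen_subgroup S).

Definition Cyc (T : groupType) (A : set T) : set T :=
  [set x | A x /\ forall y, A y -> is_cyclic (gen_subgroup [set x; y])].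

Record simple_graph := SimpleGraph {
  vertex : Type;
  adj : vertex -> vertex -> Prop;
  adj_sym : forall x y, adj x y -> adj y x;
  adj_irrefl : forall x, ~ adj x x
}.

Definition graph_iso (X Y : simple_graph) : Prop :=
  exists f : vertex X -> vertex Y,
    bijective f /\ forall x y, adj x y <-> adj (f x) (f y).

Section NonCyclicGraph.
Variables (T : groupType) (A : set T).

Definition noncyclic_adj (x y : set_type (A `\` Cyc A)) : Prop :=
  x <> y /\ ~ is_cyclic (gen_subgroup [set val x; val y]).

Lemma noncyclic_adj_sym x y : noncyclic_adj x y -> noncyclic_adj y x.
Proof. by case=> xy nc; split; [exact: nesym | rewrite setUC]. Qed.

Lemma noncyclic_adj_irrefl x : ~ noncyclic_adj x x.
Proof. by case. Qed.

Definition noncyclic_graph : simple_graph :=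
  SimpleGraph noncyclic_adj_sym noncyclic_adj_irrefl.

End NonCyclicGraph.

(* The non-cyclic graph is only considered for non locally cyclic groups, so
   this condition on both sides is part of the meaning of the isomorphism. *)
Definition noncyclic_graph_iso (T U : groupType) (A : set T) (B : set U) :=
  [/\ ~ locally_cyclic A, ~ locally_cyclic B
    & graph_iso (noncyclic_graph A) (noncyclic_graph B)].

(* A group H is finite when it is isomorphic to some hT : finGroupType; the
   library notions for finite groups are transported along the isomorphism. *)
Definition finite_nilpotent (H : groupType) : Prop :=
  exists (hT : finGroupType) (f : {multiplicative H -> hT}),
    bijective f /\ nilpotent [set: hT]%G.

Definition is_Sylow (p : nat) (H : groupType) (Q : set H) : Prop :=
  exists (hT : finGroupType) (f : {multiplicative H -> hT}) (S : {group hT}),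
    [/\ bijective f, p.-Sylow([set: hT]%G) S & Q = f @^-1` [set` S]].

(* Main.v *)
(* Call x, y cocyclic when <x, y> is cyclic.  As Cyc is trivial on both sides, a
   graph isomorphism extends to a bijection G -> H preserving cocyclicity; in
   particular H is finite.  The intersection I(x) of the maximal cyclic subgroups
   containing x is { y | N[x] <= N[y] }, where N is the closed neighbourhood for
   cocyclicity, so the graph determines |I(x)|.  The elements with the same
   neighbourhood as x are those of the cyclic group I(x) lying in no smaller
   I(y); hence all elements of order d of I(x) are among them, or none are, and
   which case holds depends only on the orders |I(y)|.  So the bijection can be
   rearranged inside these classes to preserve orders of elements as well.
   Counting p-elements then shows that a Sylow p-subgroup of H consists of all
   the p-elements of H: it is normal, and the bijection maps the Sylow p-subgroup
   of G onto it.  If a Sylow subgroup P <> 1 of G were cyclic, P would lie in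
   Cyc(G) because the p-part and the p'-part of G commute. *)
Require Import Defs.
From HB Require Import structures.
From mathcomp Require Import all_boot all_fingroup all_solvable.

Set Implicit Arguments.
Unset Strict Implicit.
Unset Printing Implicit Defensive.

Local Open Scope group_scope.

(** * Cyclic pairs in a finite group *)

Section CyclicPairs.
Variables (gT : finGroupType) (G : {group gT}).
Implicit Types x y z : gT.

Definition cocyclic x y := cyclic <<[set x; y]>>.

Lemma cocyclicP x y : reflect (exists2 z, x \in <[z]> & y \in <[z]>) (cocyclic x y).
Proof.
apply: (iffP idP) => [/cyclicP[z xyz] | [z xz yz]].
  by exists z; rewrite -xyz mem_gen // !inE eqxx ?orbT.
by apply: cyclicS (cycle_cyclic z); rewrite gen_subG subUset !sub1set xz.
Qed.

Lemma cocyclicC x y : cocyclic x y = cocyclic y x.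
Proof. by rewrite /cocyclic setUC. Qed.

Lemma cocyclic_genP x y : x \in G -> y \in G -> cocyclic x y ->
  exists z, [/\ z \in G, x \in <[z]> & y \in <[z]>].
Proof.
move=> Gx Gy /cyclicP[z xyz]; exists z; rewrite -cycle_subG -xyz.
by rewrite gen_subG subUset !sub1set Gx !mem_gen // !inE eqxx ?orbT.
Qed.

(** An element of maximal order lies with any other element in a cyclic subgroup, which by
    maximality is the one it already generates. *)
Lemma cocyclic_clique_cyclic : {in G &, forall x y, cocyclic x y} -> cyclic G.
Proof.
move=> cG; have [c Gc cmax] := @arg_maxnP _ 1 [in G] (fun x => #[x]) (group1 G).
rewrite /= in Gc; apply/cyclicP; exists c; apply/eqP; rewrite eqEsubset cycle_subG Gc andbT.
apply/subsetP=> y Gy; have [z [Gz cz yz]] := cocyclic_genP Gc Gy (cG _ _ Gc Gy).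
suff -> : <[c]> = <[z]> by [].
by apply/eqP; rewrite eqEcard cycle_subG cz; exact: cmax.
Qed.

Definition conbhd x := [set y in G | cocyclic x y].

(* The intersection of the maximal cyclic subgroups of [G] containing [x]. *)
Definition cyc_core x := [set y in G | conbhd x \subset conbhd y].

Lemma mem_cyc_core x : x \in G -> x \in cyc_core x.
Proof. by move=> Gx; rewrite inE Gx subxx. Qed.

Lemma sub_conbhdP x y : reflect {in G, forall z, cocyclic x z -> cocyclic y z}
  (conbhd x \subset conbhd y).
Proof.
apply: (iffP subsetP) => sxy z.
  by move=> Gz xz; have := sxy z; rewrite !inE Gz xz => /(_ isT).
by rewrite !inE => /andP[Gz]; rewrite Gz; exact: sxy.
Qed.

(** A cyclic subgroup containing [x] can be enlarged to a cyclic one containing [y], and that one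
    again to contain [y'], since [x] stays inside at each stage. *)
Lemma cyc_core_group_set x : x \in G -> group_set (cyc_core x).
Proof.
move=> Gx; apply/group_setP; split.
  rewrite inE group1; apply/sub_conbhdP=> z _ _.
  by apply/cocyclicP; exists z; rewrite ?cycle_id ?group1.
move=> y y'; rewrite !inE => /andP[Gy /sub_conbhdP xy] /andP[Gy' /sub_conbhdP xy'].
rewrite groupM //; apply/sub_conbhdP=> z Gz xz.
have [c [Gc xc zc]] := cocyclic_genP Gx Gz xz.
have /xy yc : cocyclic x c by apply/cocyclicP; exists c; rewrite ?cycle_id.
have [d [Gd yd cd]] := cocyclic_genP Gy Gc (yc Gc).
have sd u : u \in <[c]> -> u \in <[d]> by apply: subsetP; rewrite cycle_subG.
have /xy' y'd : cocyclic x d by apply/cocyclicP; exists d; rewrite ?cycle_id ?sd.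
have /cocyclicP[e y'e de] := y'd Gd.
have se u : u \in <[d]> -> u \in <[e]> by apply: subsetP; rewrite cycle_subG.
by apply/cocyclicP; exists e; [apply: groupM; first exact: se | exact/se/sd].
Qed.

Lemma cyc_core_sub_cycle x : x \in G -> exists c, cyc_core x \subset <[c]>.
Proof.
move=> Gx; pose P c := (c \in G) && (x \in <[c]>).
have Px : P x by rewrite /P Gx cycle_id.
have [c /andP[Gc xc] cmax] := arg_maxnP (fun c => #[c]) Px.
exists c; apply/subsetP=> y; rewrite inE => /andP[Gy /sub_conbhdP xy].
have /xy yc : cocyclic x c by apply/cocyclicP; exists c; rewrite ?cycle_id.
have [z [Gz yz cz]] := cocyclic_genP Gy Gc (yc Gc).
have scz : <[c]> \subset <[z]> by rewrite cycle_subG.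
suff -> : <[c]> = <[z]> by [].
apply/eqP; rewrite eqEcard scz; apply: cmax.
by rewrite /P Gz (subsetP scz).
Qed.

Lemma conbhd_cyc_core x y : x \in G -> y \in G ->
  (conbhd x \subset conbhd y) = (cyc_core y \subset cyc_core x).
Proof.
move=> Gx Gy; apply/idP/subsetP=> [sxy u | s].
  by rewrite !inE => /andP[-> /(subset_trans sxy)].
by have := s y (mem_cyc_core Gy); rewrite inE => /andP[].
Qed.

Lemma card_order_cyclic (C : {group gT}) d : cyclic C ->
  #|[set x in C | #[x] == d]| = (if d %| #|C| then totient d else 0%N).
Proof.
case/cyclicP=> c ->; case: ifPn => [dC | ndC]; last first.
  apply: eq_card0 => x; rewrite !inE; apply: contraNF ndC => /andP[xc /eqP <-].
  exact: order_dvdG.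
have [a ac <-] : exists2 a, a \in <[c]> & #[a] = d.
  exists (c ^+ (#[c] %/ d)); first exact: mem_cycle.
  rewrite orderXdiv ?dvdn_div // divnA ?mulKn //.
rewrite totient_gen; apply: eq_card => x; rewrite !inE /generator.
case cx: (x \in <[c]>) => /=.
  by rewrite (eq_subG_cyclic (cycle_cyclic c)) ?cycle_subG // eq_sym.
apply/esym; apply: contraFF cx => /eqP ax.
by rewrite -cycle_subG -ax cycle_subG.
Qed.

(** In the cyclic group [cyc_core x], all elements of order [d] generate the same subgroup. If a
    smaller core has order divisible by [d], it contains them all and none has the neighbourhood of
    [x]; otherwise each of them has [cyc_core x] as its own core. *)
Lemma card_conbhd_order x d : x \in G ->
  #|[set y in G | (conbhd y == conbhd x) && (#[y] == d)]| =
  if (d %| #|cyc_core x|) && [forall y in G,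
       (cyc_core y \proper cyc_core x) ==> ~~ (d %| #|cyc_core y|)]
  then totient d else 0%N.
Proof.
move=> Gx; pose C := Group (cyc_core_group_set Gx).
have [c sCc] := cyc_core_sub_cycle Gx.
have cycC : cyclic C := @cyclicS _ _ C sCc (cycle_cyclic c).
have nbC y : y \in G -> conbhd y = conbhd x -> y \in C.
  by move=> Gy nyx; rewrite inE Gy nyx /=.
case: (boolP [forall y in G, _]) => [/forall_inP noy | /forall_inPn[y Gy]].
  rewrite andbT -(card_order_cyclic d cycC); apply: eq_card => y; rewrite !inE.
  case Gy: (y \in G) => //=; case: (#[y] =P d) => [oy|_]; rewrite ?andbF // !andbT.
  apply/eqP/idP => [-> // | sxy]; apply/eqP; rewrite eqEsubset sxy andbT.
  have := noy y Gy; rewrite -oy.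
  have -> : #[y] %| #|cyc_core y|.
    rewrite -[cyc_core y]/(gval (Group (cyc_core_group_set Gy))).
    exact/order_dvdG/mem_cyc_core.
  rewrite implybF properE -!conbhd_cyc_core // sxy /= negbK //.
rewrite negb_imply negbK => /andP[pyx dy]; rewrite andbF.
apply: eq_card0 => z; rewrite !inE; apply/negP=> /and3P[Gz /eqP nzx /eqP oz].
have zC : z \in C by apply: nbC.
pose D := Group (cyc_core_group_set Gy).
have sDC : D \subset C by apply: proper_sub.
have zD : z \in D.
  rewrite -cycle_subG -(cardSg_cyclic cycC) ?cycle_subG //.
  by rewrite [#|_|]oz.
move: zD; rewrite inE => /andP[_]; rewrite nzx conbhd_cyc_core // => sxy.
by move: pyx; rewrite properE sxy andbF.
Qed.

End CyclicPairs.

(** Fibres over the same key are matched by position in their enumerations; [y0] serves as the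
    default of [nth]. *)
Lemma exists_fiber_bij (T U : finType) (K : eqType) (A : {set T}) (B : {set U})
    (f : T -> K) (g : U -> K) (y0 : U) :
    (forall k, #|[set x in A | f x == k]| = #|[set y in B | g y == k]|) ->
  exists h : T -> U,
    [/\ {in A &, injective h}, h @: A = B & {in A, forall x, g (h x) = f x}].
Proof.
move=> eqfg; pose F k := enum [set x in A | f x == k].
pose F' k := enum [set y in B | g y == k].
have szF k : size (F k) = size (F' k) by rewrite -!cardE.
pose h x := nth y0 (F' (f x)) (index x (F (f x))).
have xF x : x \in A -> x \in F (f x) by rewrite mem_enum inE eqxx andbT.
have hF' x : x \in A -> h x \in F' (f x).
  by move=> Ax; rewrite mem_nth // -szF index_mem xF.
have gh : {in A, forall x, g (h x) = f x}.
  by move=> x /hF'; rewrite mem_enum inE => /andP[_ /eqP].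
exists h; split=> //.
  move=> x x' Ax Ax' eqh; have eqf : f x = f x' by rewrite -!gh // eqh.
  move/eqP: eqh; rewrite /h -eqf nth_uniq ?enum_uniq -?szF ?index_mem ?xF //.
    by move/eqP/index_inj => ->; rewrite ?xF // eqf xF.
  by rewrite eqf xF.
apply/setP=> y; apply/imsetP/idP => [[x /hF' + ->]|By].
  by rewrite mem_enum inE => /andP[].
have yF' : y \in F' (g y) by rewrite mem_enum inE By eqxx.
have ltF : index y (F' (g y)) < size (F (g y)) by rewrite szF index_mem.
case def_x: (F (g y)) (ltF) => [//|x0 s] _.
pose x := nth x0 (F (g y)) (index y (F' (g y))).
have: x \in F (g y) by rewrite mem_nth.
rewrite mem_enum inE => /andP[Ax /eqP fx]; exists x => //.
by rewrite /h fx index_uniq ?enum_uniq // nth_index.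
Qed.

(** * Invariants of bijections preserving cocyclicity *)

Section CocyclicTransport.
Variables (gT hT : finGroupType) (G : {group gT}) (K : {group hT}).
Variable phi : gT -> hT.
Hypotheses (phi_inj : {in G &, injective phi}) (phiG : phi @: G = K).
Hypothesis phi_cocyclic :
  {in G &, forall x y, cocyclic (phi x) (phi y) = cocyclic x y}.

Let phi_mem x : x \in G -> phi x \in K.
Proof. by rewrite -phiG; apply: imset_f. Qed.

Let phi_surj y : y \in K -> exists2 x, x \in G & y = phi x.
Proof. by rewrite -phiG => /imsetP. Qed.

Lemma conbhd_transport : {in G &, forall x y,
  (conbhd K (phi x) \subset conbhd K (phi y)) = (conbhd G x \subset conbhd G y)}.
Proof.
move=> x y Gx Gy; apply/sub_conbhdP/sub_conbhdP => sxy z.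
  by move=> Gz; have := sxy _ (phi_mem Gz); rewrite !phi_cocyclic.
by case/phi_surj=> t Gt ->; rewrite !phi_cocyclic //; apply: sxy.
Qed.

Lemma cyc_core_transport : {in G, forall x, cyc_core K (phi x) = phi @: cyc_core G x}.
Proof.
move=> x Gx; apply/setP=> y; apply/idP/imsetP => [|[z + ->]]; rewrite !inE.
  case/andP=> /phi_surj[z Gz ->]; rewrite conbhd_transport // => sxz.
  by exists z; rewrite // inE Gz.
by case/andP=> Gz sxz; rewrite phi_mem // conbhd_transport.
Qed.

Lemma card_cyc_core_transport : {in G, forall x, #|cyc_core K (phi x)| = #|cyc_core G x|}.
Proof.
move=> x Gx; rewrite cyc_core_transport // card_in_imset // => y z.
by rewrite !inE => /andP[Gy _] /andP[Gz _]; apply: phi_inj.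
Qed.

(** For fixed [d], the count in [card_conbhd_order] depends only on the orders of the cores and on
    their inclusions, and [phi] preserves both. *)
Lemma card_conbhd_order_transport x d : x \in G ->
  #|[set y in G | (conbhd G y == conbhd G x) && (#[y] == d)]| =
  #|[set y in K | (conbhd K y == conbhd K (phi x)) && (#[y] == d)]|.
Proof.
move=> Gx; rewrite !card_conbhd_order ?phi_mem // card_cyc_core_transport //.
congr (if _ && _ then _ else _).
have proper_transport y : y \in G ->
    (cyc_core K (phi y) \proper cyc_core K (phi x)) =
    (cyc_core G y \proper cyc_core G x).
  move=> Gy; rewrite !properE -!conbhd_cyc_core ?phi_mem //.
  by rewrite !conbhd_transport.
apply/forall_inP/forall_inP => noy y.
  case/phi_surj=> z Gz ->; rewrite proper_transport // card_cyc_core_transport //.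
  exact: noy.
move=> Gy; have := noy _ (phi_mem Gy).
by rewrite proper_transport // card_cyc_core_transport.
Qed.

(* [phi] itself need not preserve orders, but it can be permuted within the
   classes of vertices having the same closed neighbourhood. *)
Lemma exists_order_preserving_transport : exists psi : gT -> hT,
  [/\ {in G &, injective psi}, psi @: G = K,
      {in G &, forall x y, cocyclic (psi x) (psi y) = cocyclic x y}
    & {in G, forall x, #[psi x] = #[x]}].
Proof.
have eq_conbhd x y : x \in G -> y \in G ->
    (conbhd K (phi x) == conbhd K (phi y)) = (conbhd G x == conbhd G y).
  by move=> Gx Gy; rewrite !eqEsubset !conbhd_transport.
(* Both keys pair a closed neighbourhood in [K] with an order; [x] contributes the neighbourhood of
   [phi x] but its own order. *)
case: (@exists_fiber_bij gT hT _ G K (fun x => (conbhd K (phi x), #[x]))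
  (fun y => (conbhd K y, #[y])) 1) => [[S d] | psi [psi_inj psiG psi_key]].
  have [/exists_inP[x Gx /eqP <-] | noS] := boolP [exists x in G, conbhd K (phi x) == S].
    rewrite -[RHS](card_conbhd_order_transport d Gx).
    apply: eq_card => y; rewrite !inE xpair_eqE.
    by case Gy: (y \in G); rewrite //= eq_conbhd.
  rewrite !eq_card0 // => y; rewrite !inE xpair_eqE; apply: contraNF noS.
    by case/and3P=> /phi_surj[x Gx ->] yS _; apply/exists_inP; exists x.
  by case/and3P=> Gy yS _; apply/exists_inP; exists y.
exists psi; split=> // [x y Gx Gy | x Gx]; last by case: (psi_key x Gx).
have psiK z : z \in G -> psi z \in K by rewrite -psiG; apply: imset_f.
(* [psi z] and [phi z] have the same neighbourhood in [K], so one can replace the other, one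
   argument at a time. *)
have nb z u : z \in G -> u \in K -> cocyclic (psi z) u = cocyclic (phi z) u.
  move=> Gz Ku; have [/setP/(_ u) + _] := psi_key z Gz.
  by rewrite !inE Ku.
by rewrite nb ?psiK // cocyclicC nb ?phi_mem // phi_cocyclic // cocyclicC.
Qed.

End CocyclicTransport.

(** * Nilpotency from element orders *)

Section NilpotentByOrders.
Variables (gT hT : finGroupType) (G : {group gT}) (K : {group hT}).
Hypothesis nilG : nilpotent G.

Lemma nilpotent_Sylow_p_elt p (P : {group gT}) :
  p.-Sylow(G) P -> P :=: [set x in G | p.-elt x].
Proof.
move=> sylP; apply/setP=> x; rewrite inE; apply/idP/andP => [Px|[Gx px]].
  by rewrite (subsetP (pHall_sub sylP)) // (mem_p_elt (pHall_pgroup sylP)).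
have nP : P <| G by rewrite (nilpotent_Hall_pcore nilG sylP) pcore_normal.
by rewrite (mem_normal_Hall sylP nP).
Qed.

(** If [z] generates [P], the product [w] of [z] with the p'-part of [y] has these commuting factors
    as its p-part and p'-part. So [<[w]>] contains both, hence also [P] and with it the p-part of
    [y]. *)
Lemma cyclic_Sylow_cocyclic p (P : {group gT}) :
  p.-Sylow(G) P -> cyclic P -> {in P & G, forall x y, cocyclic x y}.
Proof.
move=> sylP /cyclicP[z defP] x y Px Gy.
have Pz : z \in P by rewrite defP cycle_id.
have pz : p.-elt z := mem_p_elt (pHall_pgroup sylP) Pz.
have Pyp : y.`_p \in P.
  rewrite (nilpotent_Sylow_p_elt sylP) inE p_elt_constt andbT.
  exact: groupX.
have czy : commute z y.`_p^'.
  have /dprodP[_ _ cOO' _] := nilpotent_pcoreC p nilG.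
  apply/commute_sym; apply: (centsP cOO').
    rewrite (mem_normal_Hall (nilpotent_pcore_Hall p^' nilG) (pcore_normal _ _)).
      exact: p_elt_constt.
    exact: groupX.
  by have := Pz; rewrite {1}(nilpotent_Hall_pcore nilG sylP).
pose w := z * y.`_p^'; have pNy : p^'.-elt y.`_p^' := p_elt_constt _ _.
have wz : z \in <[w]>.
  suff {1}-> : z = w.`_p by apply: cycle_constt.
  rewrite consttM // (constt_p_elt pz) (constt1P _) ?mulg1 //.
have wy : y.`_p^' \in <[w]>.
  suff {1}-> : y.`_p^' = w.`_p^' by apply: cycle_constt.
  rewrite consttM // (constt_p_elt pNy) [z.`_p^'](constt1P _) ?mul1g //.
  by rewrite p_eltNK.
have sPw u : u \in P -> u \in <[w]>.
  by apply: subsetP; rewrite defP cycle_subG.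
apply/cocyclicP; exists w; first exact: sPw.
by rewrite -(consttC p y) groupM ?(sPw _ Pyp).
Qed.

Variable psi : gT -> hT.
Hypotheses (psi_inj : {in G &, injective psi}) (psiG : psi @: G = K).
Hypothesis psi_order : {in G, forall x, #[psi x] = #[x]}.

Lemma p_elt_transport p :
  [set y in K | p.-elt y] = psi @: [set x in G | p.-elt x].
Proof.
apply/setP=> y; rewrite inE -psiG; apply/andP/imsetP => [[/imsetP[x Gx ->]] | [x]].
  by rewrite /p_elt psi_order // => px; exists x; rewrite // inE Gx.
rewrite inE => /andP[Gx px] ->; rewrite imset_f //.
by rewrite /p_elt psi_order.
Qed.

(** [S] consists of p-elements, and equality follows by counting: [K] has as many p-elements as [G],
    namely the order of a Sylow subgroup of [G], and [G] and [K] have the same order. *)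
Lemma Sylow_p_elt_transport p (S : {group hT}) :
  p.-Sylow(K) S -> S :=: [set y in K | p.-elt y].
Proof.
move=> sylS; apply/eqP; rewrite eqEcard; apply/andP; split.
  apply/subsetP=> y Sy; rewrite inE (subsetP (pHall_sub sylS)) //.
  exact: mem_p_elt (pHall_pgroup sylS) Sy.
have [P sylP] := Sylow_exists p G.
rewrite p_elt_transport card_in_imset => [|x y]; last first.
  by rewrite !inE => /andP[Gx _] /andP[Gy _]; apply: psi_inj.
rewrite -(nilpotent_Sylow_p_elt sylP) (card_Hall sylP) (card_Hall sylS).
by rewrite -psiG card_in_imset.
Qed.

(** A Sylow subgroup that is the set of all p-elements is stable under conjugation, hence lies in
    the Fitting subgroup. So each p-part of the order of [K] divides the order of ['F(K)]. *)
Lemma nilpotent_order_transport : nilpotent K.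
Proof.
suff -> : K :=: 'F(K) by apply: Fitting_nil.
apply/eqP; rewrite eq_sym eqEcard Fitting_sub dvdn_leq //.
apply/dvdn_partP=> // p _; have [S sylS] := Sylow_exists p K.
rewrite -(card_Hall sylS) cardSg // Fitting_max ?(pgroup_nil (pHall_pgroup sylS)) //.
rewrite /normal (pHall_sub sylS) /=; apply/normsP=> x Kx.
apply/setP=> y; rewrite mem_conjg (Sylow_p_elt_transport sylS) !inE.
by rewrite groupJr ?groupV // p_eltJ.
Qed.

Lemma Sylow_transport p (P : {group gT}) (S : {group hT}) :
  p.-Sylow(G) P -> p.-Sylow(K) S -> psi @: P = S.
Proof.
move=> sylP sylS; rewrite (Sylow_p_elt_transport sylS) p_elt_transport.
by rewrite -(nilpotent_Sylow_p_elt sylP).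
Qed.

End NilpotentByOrders.

(** * Passage to possibly infinite groups *)

From mathcomp Require Import boolp classical_sets functions cardinality.

Local Open Scope classical_set_scope.
Local Open Scope group_scope.

Lemma gen_subgroupP (T : groupType) (S : set T) x : gen_subgroup S x <->
  forall B : set T, B 1 -> (forall u v, B u -> B v -> B (u * v^-1)) ->
    S `<=` B -> B x.
Proof.
split=> [Sx B B1 BV SB | Sx B [[B1 BV] SB]].
  apply: Sx; split=> //; split; first exact: mem_set.
  by move=> u v /set_mem Bu /set_mem Bv; apply/mem_set/BV.
apply: Sx => //; first exact: (set_mem B1).
by move=> u v Bu Bv; apply/set_mem/BV; apply: mem_set.
Qed.

Lemma gen_subgroup_fin (gT : finGroupType) (S : set gT) (A : {set gT}) :
  S = [set` A] -> gen_subgroup S = [set` <<A>>].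
Proof.
move=> ->; apply/seteqP; split=> x.
  move/gen_subgroupP; apply=> [|u v /= uA vA|u /= uA]; first exact: group1.
    by rewrite groupM ?groupV.
  exact: mem_gen.
move=> /= xA; apply/gen_subgroupP=> B B1 BV SB.
pose D := [set u | `[< B u >]]%SET.
have BD u : (u \in D) <-> B u by rewrite inE; split=> /asboolP.
have gD : group_set D.
  apply/group_setP; split=> [|u v /BD Bu /BD Bv]; first exact/BD.
  (* Closure under products comes from writing [u * v] as [u * (1 * v^-1)^-1]. *)
  apply/BD; rewrite -[v]invgK; apply: (BV _ _ Bu).
  by rewrite -[_^-1]mul1g; apply: BV.
have: x \in Group gD.
  by apply: fintype.subsetP x xA; rewrite gen_subG; apply/fintype.subsetP=> u /SB /BD.
by move/BD.
Qed.

Lemma is_cyclic_pairE (gT : finGroupType) (x y : gT) :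
  is_cyclic (gen_subgroup [set x; y]) <-> cocyclic x y.
Proof.
have gen1 z : gen_subgroup [set z] = [set` <[z]> ].
  by apply: gen_subgroup_fin; apply/seteqP; split=> u /=; rewrite inE => /eqP.
have gen2 : gen_subgroup [set x; y] = [set` <<[set x; y]%SET>>].
  apply: gen_subgroup_fin; apply/seteqP; split=> u /=.
    by case=> ->; rewrite !inE eqxx ?orbT.
  by rewrite !inE => /orP[]/eqP ->; [left | right].
rewrite /is_cyclic gen2; split=> [[z] | /cyclicP[z xyz]].
  rewrite gen1 => /seteqP[xyz zxy]; apply/cyclicP; exists z; apply/setP=> u.
  by apply/idP/idP; [apply: xyz | apply: zxy].
by exists z; rewrite gen1 xyz.
Qed.

Section Isomorphism.
Variables (T U : groupType) (f : {multiplicative T -> U}).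

Lemma multiplicative1 : f 1 = 1.
Proof. by apply: (mulgI (f 1)); rewrite -gmulfM !mulg1. Qed.

Lemma multiplicativeV x : f x^-1 = (f x)^-1.
Proof. by apply: (mulgI (f x)); rewrite -gmulfM !mulgV multiplicative1. Qed.

Lemma gen_subgroup_image (S : set T) : bijective f ->
  f @` gen_subgroup S = gen_subgroup (f @` S).
Proof.
case=> g fK gK; apply/seteqP; split=> [_ [x /gen_subgroupP Sx <-] | y /gen_subgroupP Sy].
  apply/gen_subgroupP=> B B1 BV SB; apply: (Sx (f @^-1` B)) => /=.
  - by rewrite multiplicative1.
  - by move=> u v Bu Bv; rewrite gmulfM multiplicativeV; apply: BV.
  by move=> u Su; apply: SB; exists u.
apply: Sy.
- exists 1; last exact: multiplicative1.
  by apply/gen_subgroupP.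
- move=> _ _ [u /gen_subgroupP Su <-] [v /gen_subgroupP Sv <-].
  exists (u * v^-1); last by rewrite gmulfM multiplicativeV.
  apply/gen_subgroupP=> B B1 BV SB.
  by apply: (BV); [exact: (Su _ B1 BV SB) | exact: (Sv _ B1 BV SB)].
move=> _ [x Sx <-]; exists x => //.
by apply/gen_subgroupP=> B _ _; apply.
Qed.

Lemma is_cyclic_pair_image (x y : T) : bijective f ->
  is_cyclic (gen_subgroup [set f x; f y]) <-> is_cyclic (gen_subgroup [set x; y]).
Proof.
move=> bij_f; have [g fK gK] := bij_f.
have <- : f @` [set x; y] = [set f x; f y] by rewrite image_setU !image_set1.
rewrite -gen_subgroup_image //; split=> -[z].
  rewrite -(gK z) -image_set1 -gen_subgroup_image // => e; exists (g z).
  apply/seteqP; split=> u Su.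
    have: (f @` gen_subgroup [set x; y]) (f u) by exists u.
    by rewrite e => -[v Sv /(can_inj fK) <-].
  have: (f @` gen_subgroup [set g z]) (f u) by exists u.
  by rewrite -e => -[v Sv /(can_inj fK) <-].
by move=> ->; exists (f z); rewrite gen_subgroup_image // image_set1.
Qed.

End Isomorphism.

Lemma card_eq1 (T : Type) (A : set T) : (A #= `I_1)%card -> exists x, A = [set x].
Proof.
case/card_bijP=> h [g hK gK].
have I1 : (0%N \in `I_1) by apply: mem_set.
exists (val (g (exist _ 0%N I1))); apply/seteqP; split=> [x Ax | _ ->]; last exact: set_valP.
have -> : exist _ 0%N I1 = h (exist _ x (mem_set Ax)); last by rewrite hK.
apply: val_inj; case: (h _) => n /= /set_mem /=.
by rewrite ltnS leqn0 => /eqP.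
Qed.

(** * Graph isomorphisms versus bijections preserving cyclic pairs *)

Section GraphIsomorphism.
Variables (T U : groupType) (A : set T) (B : set U).

(** The vertex bijection extends by sending the only element of [Cyc A] to that of [Cyc B]. Distinct
    vertices form a cyclic pair exactly when they are not adjacent; pairs meeting [Cyc] and repeated
    elements are always cyclic. *)
Lemma graph_iso_set_bij : (Cyc A #= `I_1)%card -> (Cyc B #= `I_1)%card ->
    graph_iso (noncyclic_graph A) (noncyclic_graph B) ->
  exists2 phi : T -> U, set_bij A B phi &
    forall x y, A x -> A y -> is_cyclic (gen_subgroup [set phi x; phi y]) <->
                              is_cyclic (gen_subgroup [set x; y]).
Proof.
move=> /card_eq1[c Ac] /card_eq1[d Bd] [F [[F' FK F'K] F_adj]].
have [Acc cycc] : Cyc A c by rewrite Ac.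
have [Bdd cycd] : Cyc B d by rewrite Bd.
pose phi x := if pselect ((A `\` Cyc A) x) is left h
              then val (F (exist _ x (mem_set h))) else d.
have phiE (v : set_type (A `\` Cyc A)) : phi (val v) = val (F v).
  rewrite /phi; case: pselect => [h | []]; last exact: set_valP.
  by congr (val (F _)); apply: val_inj.
have phic : phi c = d by rewrite /phi; case: pselect => // -[_ []]; rewrite Ac.
have AP x : A x -> x = c \/ exists v : set_type (A `\` Cyc A), x = val v.
  move=> Ax; have [-> | xc] := pselect (x = c); first by left.
  have Vx : (A `\` Cyc A) x by split=> //; rewrite Ac.
  by right; exists (exist _ x (mem_set Vx)).
have valB (w : set_type (B `\` Cyc B)) : B (val w) by have [] := set_valP w.
have val_neq_d (w : set_type (B `\` Cyc B)) : val w <> d.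
  by move=> e; have [_ nw] := set_valP w; apply: nw; rewrite e.
have cyc_refl (V : groupType) (x : V) : is_cyclic (gen_subgroup [set x; x]).
  by exists x; rewrite setUid.
exists phi.
  split.
  - by move=> x /AP[-> | [v ->]]; rewrite ?phic ?phiE.
  - move=> x y /set_mem/AP[-> | [v ->]] /set_mem/AP[-> | [w ->]] //; rewrite ?phic ?phiE.
    + by move=> e; case: (val_neq_d (F w)).
    + by move=> e; case: (val_neq_d (F v)).
    by move/val_inj/(can_inj FK) ->.
  move=> y By; have [-> | yd] := pselect (y = d); first by exists c.
  have Vy : (B `\` Cyc B) y by split=> //; rewrite Bd.
  have [Av _] := set_valP (F' (exist _ y (mem_set Vy))).
  by exists (val (F' (exist _ y (mem_set Vy)))); rewrite ?phiE ?F'K.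
move=> x y /AP[-> | [v ->]] /AP[-> | [w ->]]; rewrite ?phic ?phiE.
- by split=> _; apply: cyc_refl.
- by split=> _; [apply: cycc; case: (set_valP w) | apply: cycd].
- by rewrite setUC [X in _ <-> is_cyclic (gen_subgroup X)]setUC;
    split=> _; [apply: cycc; case: (set_valP v) | apply: cycd].
have [-> | vw] := pselect (v = w); first by split=> _; apply: cyc_refl.
have Fvw : F v <> F w by move/(can_inj FK).
have [adjF Fadj] := F_adj v w.
by split=> cyc; apply: contrapT => nc; [case: adjF | case: Fadj].
Qed.

(** Membership in [Cyc] is expressed through cyclic pairs, so [psi] maps [Cyc A] onto [Cyc B] and
    restricts to the vertices. *)
Lemma set_bij_graph_iso (psi : T -> U) : set_bij A B psi ->
    (forall x y, A x -> A y -> is_cyclic (gen_subgroup [set psi x; psi y]) <->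
                               is_cyclic (gen_subgroup [set x; y])) ->
  graph_iso (noncyclic_graph A) (noncyclic_graph B).
Proof.
move=> [psiAB psi_inj psi_surj] cycE.
have CycE x : A x -> Cyc B (psi x) <-> Cyc A x.
  move=> Ax; split=> -[_ cx]; split=> //; last first.
  - by move=> _ /psi_surj[y Ay <-]; apply/cycE => //; apply: cx.
  - exact: psiAB.
  by move=> y Ay; apply/cycE => //; apply/cx/psiAB.
have vB (v : set_type (A `\` Cyc A)) : (B `\` Cyc B) (psi (val v)).
  by have [Av nv] := set_valP v; split; [apply: psiAB | rewrite CycE].
have Finj (v w : set_type (A `\` Cyc A)) : psi (val v) = psi (val w) -> v = w.
  have [Av _] := set_valP v; have [Aw _] := set_valP w.
  by move/psi_inj => e; apply/val_inj/e; apply: mem_set.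
pose F v : set_type (B `\` Cyc B) := exist _ (psi (val v)) (mem_set (vB v)).
have Fsurj w : exists v, F v = w.
  have [Bw nw] := set_valP w; have [x Ax xw] := psi_surj _ Bw.
  have Vx : (A `\` Cyc A) x by split=> //; rewrite -CycE // xw.
  by exists (exist _ x (mem_set Vx)); apply: val_inj.
exists F; split.
  exists (fun w => projT1 (cid (Fsurj w))) => [v | w]; last by case: cid.
  by case: cid => u /= /(congr1 val) /= /Finj.
move=> v w; have [Av _] := set_valP v; have [Aw _] := set_valP w.
rewrite /= /noncyclic_adj /= cycE //.
split=> -[vw nc]; split=> //; first by move/(congr1 val) => /= /Finj.
by move=> e; apply: vw; rewrite e.
Qed.

End GraphIsomorphism.

(** The carrier of [hT] is [H] itself, made finite by a duplicate-free enumeration; the isomorphism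
    is the identity. *)
Lemma finite_groupType (H : groupType) : finite_set [set: H] ->
  exists (hT : finGroupType) (f : {multiplicative H -> hT}), bijective f.
Proof.
move=> /finite_seqP[s Hs].
have ax : Finite.axiom (undup s).
  apply: Finite.uniq_enumP (undup_uniq s) _ => x; rewrite mem_undup.
  by have : [set` s] x by rewrite -Hs.
pose cM := @PCanIsCountable nat H _ _ (@fin_pickleK H (undup s) ax).
pose hT : finGroupType := HB.pack H cM (isFinite.Build H ax).
have mM : {morph (id : H -> hT) : x y / x * y} by [].
exists hT, (HB.pack_for {multiplicative H -> hT} (id : H -> hT)
              (isMultiplicative.Build H hT id mM)).
by exists id.
Qed.

Theorem theorem7p3 (gT : finGroupType) (G : {group gT}) (H : groupType)
    (G_noncyclic : ~~ cyclic G) (G_nilpotent : nilpotent G)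
    (CycG1 : (Cyc [set` G] #= `I_1)%card) (CycH1 : (Cyc [set: H] #= `I_1)%card)
    (GH_iso : noncyclic_graph_iso [set` G] [set: H]) :
  finite_nilpotent H /\
  forall p : nat, prime p -> p %| #|G| ->
    forall (P : {group gT}) (Q : set H),
      p.-Sylow(G) P -> is_Sylow p Q -> noncyclic_graph_iso [set` P] Q.
Proof.
have [_ _ graphGH] := GH_iso.
have [phi0 [phi0G phi0_inj phi0_surj] phi0_cyc] := graph_iso_set_bij CycG1 CycH1 graphGH.
(* Stated for every finite copy [hT] of [H]: nilpotency uses one that is constructed, the Sylow part
   the one supplied by [is_Sylow]. *)
have transport (hT : finGroupType) (f : {multiplicative H -> hT}) : bijective f ->
    exists psi : gT -> hT, [/\ {in G &, injective psi}, psi @: G = [set: hT]%SET,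
      {in G &, forall x y, cocyclic (psi x) (psi y) = cocyclic x y}
    & {in G, forall x, #[psi x] = #[x]}].
  move=> bij_f; have [g fK gK] := bij_f.
  apply: (@exists_order_preserving_transport _ _ G [set: hT]%G (f \o phi0)).
  - move=> x y Gx Gy /= /(can_inj fK) e; apply: phi0_inj e; exact: mem_set.
  - apply/setP=> y; rewrite !inE; apply/imsetP.
    by have [x Gx /= e] := phi0_surj (g y) I; exists x; rewrite //= e gK.
  move=> x y Gx Gy /=; apply/idP/idP => /is_cyclic_pairE cxy; apply/is_cyclic_pairE.
    by apply/phi0_cyc => //; apply/(is_cyclic_pair_image _ _ bij_f).
  by apply/(is_cyclic_pair_image _ _ bij_f)/phi0_cyc.
split.
  have [|hT [f bij_f]] := @finite_groupType H.
    suff -> : [set: H] = phi0 @` [set` G] by apply/finite_image/finite_finset.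
    by apply/seteqP; split=> // y _; apply: phi0_surj.
  exists hT, f; split=> //; have [psi [psi_inj psiG _ psi_order]] := transport _ f bij_f.
  exact: (@nilpotent_order_transport _ _ G [set: hT]%G _ psi).
move=> p p_pr p_dvd P Q sylP [hT [f [S [bij_f sylS ->]]]].
have [psi [psi_inj psiG psi_cyc psi_order]] := transport _ f bij_f.
have psiP : psi @: P = S.
  by apply: (Sylow_transport G_nilpotent psi_inj psiG psi_order sylP sylS).
have sPG x : x \in P -> x \in G by apply: fintype.subsetP (pHall_sub sylP) x.
have [g fK gK] := bij_f.
(* If [P] were cyclic, it would lie in the one-element set [Cyc] of [G] and be trivial, although [p]
   divides the order of [G]. *)
have noncycP : ~~ cyclic P.
  apply/negP=> cycP; have [c CycGc] := card_eq1 CycG1.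
  have PCyc x : x \in P -> x = c.
    move=> Px; suff: Cyc [set` G] x by rewrite CycGc.
    split=> [|y Gy]; first exact: sPG.
    exact/is_cyclic_pairE/(cyclic_Sylow_cocyclic G_nilpotent sylP).
  have /cyclicP[z Pz] := cycP.
  have : p %| #|P|.
    rewrite (card_Hall sylP) p_part -{1}(expn1 p) dvdn_exp2l //.
    by rewrite logn_gt0 mem_primes p_pr cardG_gt0.
  suff -> : P :=: 1 by rewrite cards1 dvdn1 => /eqP p1; rewrite p1 in p_pr.
  apply/trivgP/fintype.subsetP=> x Px; rewrite inE (PCyc x Px); apply/eqP/esym/PCyc/group1.
(* [psi] lands in the finite copy [hT]; composing with [g], the inverse of [f], returns to [H]. *)
have bij : set_bij [set` P] (f @^-1` [set` S]) (g \o psi).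
  split.
  - by move=> x Px; rewrite /preimage /= gK -psiP; apply: imset_f.
  - move=> x y /set_mem Px /set_mem Py /= /(can_inj gK) e.
    by apply: psi_inj e; apply: sPG.
  move=> y; rewrite /preimage /= -psiP => /imsetP[x Px e].
  by exists x; rewrite //= -e fK.
have cycPQ x y : x \in P -> y \in P ->
    is_cyclic (gen_subgroup [set (g \o psi) x; (g \o psi) y]) <->
    is_cyclic (gen_subgroup [set x; y]).
  move=> Px Py; rewrite -(is_cyclic_pair_image _ _ bij_f) /= !gK.
  by rewrite !is_cyclic_pairE psi_cyc ?sPG.
have not_loc_cyc (T : groupType) (A : set T) x y : A x -> A y ->
    ~ is_cyclic (gen_subgroup [set x; y]) -> ~ locally_cyclic A.
  move=> Ax Ay nc /(_ [set x; y]) lcA; apply/nc/lcA; first exact: finite_set2.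
  by move=> _ [-> | ->].
(* By [cocyclic_clique_cyclic] the non-cyclic [P] contains a non-cyclic pair; this pair and its
   image in the Sylow subgroup of [H] show that neither group is locally cyclic. *)
have [x [y [Px Py nc]]] : exists x y,
    [/\ x \in P, y \in P & ~ is_cyclic (gen_subgroup [set x; y])].
  apply: contrapT => ncP; case/negP: noncycP.
  apply: cocyclic_clique_cyclic => x y Px Py; apply/is_cyclic_pairE.
  by apply: contrapT => nc; apply: ncP; exists x, y.
have [psiPQ _ _] := bij.
split; first exact: not_loc_cyc nc.
  apply: (@not_loc_cyc _ _ ((g \o psi) x) ((g \o psi) y)); try exact: psiPQ.
  by move/(cycPQ _ _ Px Py).
exact: set_bij_graph_iso bij cycPQ.
Qed.
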